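(* Let $\mathbb{K}$ be a field and let $\Gamma=\langle n_1,\dots,n_r\rangle$ be a numerical semigroup minimally generated by positive integers $n_1<\dots<n_r$, and assume that the projective closure $\mathbb{K}[\Gamma^h]=\mathbb{K}[u^{n_r},u^{n_r-n_1}v^{n_1},\dots,u^{n_r-n_{r-1}}v^{n_{r-1}},v^{n_r}]$ is not Cohen-Macaulay. Let $T^\star$ be the associated affine semigroup, minimally generated by $\{(n_r,0),(\alpha_1,\beta_1),\dots,(\alpha_s,\beta_s),(0,n_r)\}$, let $I_{T^\star}\subset\mathbb{K}[x_0,\dots,x_{s+1}]$ be the defining ideal of $\mathbb{K}[T^\star]$, and let $G$ be the reduced Gröbner basis of $I_{T^\star}$ with respect to the degree reverse lexicographic order induced by $x_1>\dots>x_s>x_{s+1}>x_0$. Then $\mathbb{K}[\Gamma^h]$ is Buchsbaum if and only if neither $x_0$ nor $x_{s+1}$ divides the leading monomial of any element of $G$.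
   Context: Set $n_0=0$ and $e_i=(n_r-n_i,n_i)$ for $0\le i\le r$. Let $T=\{(\alpha,\beta)\in\mathbb{N}^2: u^\alpha v^\beta\in\mathbb{K}[\Gamma^h]\}$, i.e. the affine semigroup generated by $e_0,\dots,e_r$. For subsets $A,B$ of $\mathbb{Z}^2$ write $A\pm B=\{a\pm b:a\in A,b\in B\}$, and put $T^\star=(T-e_0)\cap(T-e_1)\cap\dots\cap(T-e_r)$. Then $T^\star$ is a finitely generated additive subsemigroup of $\mathbb{N}^2$, which is a simplicial affine semigroup whose minimal generating set is written $\{(n_r,0),(\alpha_1,\beta_1),\dots,(\alpha_s,\beta_s),(0,n_r)\}$. The ideal $I_{T^\star}$ is the kernel of $\phi_{T^\star}:\mathbb{K}[x_0,\dots,x_{s+1}]\to\mathbb{K}[T^\star]$, $\phi_{T^\star}(x_0)=u^{n_r}$, $\phi_{T^\star}(x_j)=u^{\alpha_j}v^{\beta_j}$ for $1\le j\le s$, $\phi_{T^\star}(x_{s+1})=v^{n_r}$.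
   Formalization: The degree in ''degree reverse lexicographic order'' is the natural grading deg x_j = α_j+β_j (and n_r for x_0, x_{s+1}), under which I_{T*} is homogeneous, instead of deg x_j = 1; with deg x_j = 1 the claim fails, e.g. for Γ = ⟨5,8,9,11⟩. *)

(* Defs.v *)
From HB Require Import structures.
From mathcomp Require Import all_boot all_order all_algebra.
From mathcomp Require Import mpoly.

Set Implicit Arguments.
Unset Strict Implicit.
Unset Printing Implicit Defensive.

Import Order.TTheory GRing.Theory.
Local Open Scope ring_scope.

(* Commutative algebra of the subrings B of a field F; subrings and their
   ideals are predicates on F. The rings to which these notions are applied
   are localizations of K[Gamma^h], hence Noetherian domains. *)
Section Subrings.
Variable F : fieldType.
Implicit Types (B I J P : F -> Prop) (x y z : F) (xs : seq F).

Definition is_ideal B I : Prop :=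
  [/\ forall x, I x -> B x,
      I 0,
      forall x y, I x -> I y -> I (x + y)
    & forall b x, B b -> I x -> I (b * x)].

Definition is_prime_ideal B P : Prop :=
  [/\ is_ideal B P,
      ~ P 1
    & forall x y, B x -> B y -> P (x * y) -> P x \/ P y].

Definition is_maximal_ideal B P : Prop :=
  [/\ is_ideal B P,
      ~ P 1
    & forall J, is_ideal B J -> ~ J 1 ->
        (forall x, P x -> J x) -> forall x, J x -> P x].

Definition localization B P : F -> Prop :=
  fun x => exists a b, [/\ B a, B b, ~ P b & x = a / b].

(* For a local ring B this is its maximal ideal. *)
Definition nonunits B : F -> Prop :=
  fun x => B x /\ ~ exists2 y, B y & x * y = 1.

Definition ideal_span B xs : F -> Prop :=
  fun x => exists c : nat -> F,
    (forall i, B (c i)) /\ x = \sum_(i < size xs) c i * xs`_i.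

Definition prime_chain B (d : nat) (Q : nat -> F -> Prop) : Prop :=
  (forall i, (i <= d)%N -> is_prime_ideal B (Q i)) /\
  (forall i, (i < d)%N ->
     (forall x, Q i x -> Q i.+1 x) /\ (exists2 x, Q i.+1 x & ~ Q i x)).

Definition krull_dim B (d : nat) : Prop :=
  (exists Q, prime_chain B d Q) /\
  (forall d' Q, prime_chain B d' Q -> (d' <= d)%N).

(* The requirement B / (xs) <> 0 is automatic: xs lies in the maximal ideal. *)
Definition regular_sequence B xs : Prop :=
  (forall x, x \in xs -> nonunits B x) /\
  (forall i y, (i < size xs)%N -> B y ->
     ideal_span B (take i xs) (y * xs`_i) -> ideal_span B (take i xs) y).

Definition depth B (k : nat) : Prop :=
  (exists2 xs, regular_sequence B xs & size xs = k) /\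
  (forall xs, regular_sequence B xs -> (size xs <= k)%N).

Definition CM_local B : Prop := exists2 d, krull_dim B d & depth B d.

Definition CM_ring B : Prop :=
  forall P, is_maximal_ideal B P -> CM_local (localization B P).

Definition system_of_parameters B xs : Prop :=
  [/\ krull_dim B (size xs),
      forall x, x \in xs -> nonunits B x
    & forall z, nonunits B z -> exists k : nat, ideal_span B xs (z ^+ k)].

(* m * ((x_1, ..., x_(i-1)) : x_i) is contained in (x_1, ..., x_(i-1)). *)
Definition weak_sequence B xs : Prop :=
  forall i y, (i < size xs)%N -> B y ->
    ideal_span B (take i xs) (y * xs`_i) ->
    forall z, nonunits B z -> ideal_span B (take i xs) (y * z).

Definition Buchsbaum_local B : Prop :=
  forall xs, system_of_parameters B xs -> weak_sequence B xs.

End Subrings.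

Section Semigroups.

Definition generated (V : nmodType) (I : finType) (g : I -> V) : V -> Prop :=
  fun x => exists c : I -> nat, x = \sum_i g i *+ c i.

Definition irredundant (V : nmodType) (I : finType) (g : I -> V) : Prop :=
  forall i, ~ exists2 c : I -> nat, c i = 0%N & g i = \sum_j g j *+ c j.

Definition numerical_semigroup (S : nat -> Prop) : Prop :=
  [/\ S 0%N,
      forall a b, S a -> S b -> S (a + b)%N
    & exists N, forall a, (N <= a)%N -> S a].

Definition toZ2 (x : nat * nat) : int * int := (x.1%:Z, x.2%:Z).

Variables (r : nat) (n : nat -> nat).

Definition Gamma : nat -> Prop := generated (fun i : 'I_r => n i.+1).

Definition e (i : nat) : nat * nat := ((n r - n i)%N, n i).

Definition T : nat * nat -> Prop := generated (fun i : 'I_r.+1 => e i).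

Definition Tstar : int * int -> Prop :=
  fun z => forall i : 'I_r.+1, exists2 t, T t & z = toZ2 t - toZ2 (e i).

End Semigroups.

Section SemigroupRings.
Variable K : fieldType.

(* u^a v^b *)
Definition uv (x : nat * nat) : {mpoly K[2]} :=
  'X_ord0 ^+ x.1 * 'X_ord_max ^+ x.2.

Definition phi (k : nat) (g : 'I_k -> nat * nat) (p : {mpoly K[k]}) :
    {mpoly K[2]} :=
  p \mPo [tuple uv (g i) | i < k].

Definition toric_ideal (k : nat) (g : 'I_k -> nat * nat) :
    {mpoly K[k]} -> Prop :=
  fun p => phi g p = 0.

Variables (r : nat) (n : nat -> nat).

Definition proj_closure : {mpoly K[2]} -> Prop :=
  fun q => exists p : {mpoly K[r.+1]}, q = phi (fun i => e r n i) p.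

(* K[Gamma^h] and its irrelevant ideal, inside the field K(u, v). *)
Definition KGammah : {fraction {mpoly K[2]}} -> Prop :=
  fun x => exists2 q, proj_closure q & x = tofrac q.

Definition KGammah_irr : {fraction {mpoly K[2]}} -> Prop :=
  fun x => exists2 q, proj_closure q /\ q@_0%MM = 0 & x = tofrac q.

Definition KGammah_CM : Prop := CM_ring KGammah.

(* A positively graded K-algebra is Buchsbaum when its localization at the
   irrelevant ideal is a Buchsbaum local ring. *)
Definition KGammah_Buchsbaum : Prop :=
  Buchsbaum_local (localization KGammah KGammah_irr).

End SemigroupRings.

Section Groebner.
Variables (K : fieldType) (k : nat).
Implicit Types (lt : 'X_{1..k} -> 'X_{1..k} -> Prop) (m : 'X_{1..k}).
Implicit Types (p q : {mpoly K[k]}) (I : {mpoly K[k]} -> Prop).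

Definition is_lead_mon lt p m : Prop :=
  m \in msupp p /\ forall m', m' \in msupp p -> m' != m -> lt m' m.

(* Divisibility of monomials is the componentwise order (_ <= _)%MM. *)
Definition groebner_basis lt I (G : seq {mpoly K[k]}) : Prop :=
  (forall p, p \in G -> I p /\ p != 0) /\
  (forall p m, I p -> is_lead_mon lt p m ->
     exists q mq, [/\ q \in G, is_lead_mon lt q mq & (mq <= m)%MM]).

Definition reduced_groebner_basis lt I (G : seq {mpoly K[k]}) : Prop :=
  [/\ groebner_basis lt I G,
      uniq G,
      forall p m, p \in G -> is_lead_mon lt p m -> p@_m = 1
    & forall p q m mq, p \in G -> q \in G -> p != q ->
        m \in msupp p -> is_lead_mon lt q mq -> ~~ (mq <= m)%MM].

End Groebner.

(* Degree reverse lexicographic order on the monomials in x_0, ..., x_(s+1),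
   for x_1 > ... > x_s > x_(s+1) > x_0. The degree is the one of the natural
   grading of K[x_0, ..., x_(s+1)], in which x_j has the degree
   alpha_j + beta_j of its image u^alpha_j v^beta_j; the ideal I_(T-star) is
   homogeneous for it, and in general not for the grading deg x_j = 1. *)
Section DegRevLex.
Variables (s : nat) (g : 'I_s.+2 -> nat * nat).

Definition gdeg (m : 'X_{1..s.+2}) : nat :=
  (\sum_(j < s.+2) ((g j).1 + (g j).2) * m j)%N.

Definition var_lt (i j : 'I_s.+2) : bool :=
  ((i == ord0) && (j != ord0)) || ((j != ord0) && (j < i)%N).

Definition degrevlex (m m' : 'X_{1..s.+2}) : Prop :=
  (gdeg m < gdeg m')%N \/
  (gdeg m = gdeg m' /\
   exists i, (m' i < m i)%N /\ (forall j, var_lt j i -> m j = m' j)).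

End DegRevLex.

(* Main.v *)
Require Import Defs.
From HB Require Import structures.
From mathcomp Require Import all_boot all_order all_algebra.
From mathcomp Require Import mpoly zify ring.
From Stdlib Require Import Classical FunctionalExtensionality PropExtensionality.

Set Implicit Arguments.
Unset Strict Implicit.
Unset Printing Implicit Defensive.

Import Order.TTheory GRing.Theory.
Local Open Scope ring_scope.

(** Let [T] be the plane semigroup generated by [e_0, ..., e_r], write
    [N = n_r], and call saturated a set of points [z] that contains [z] as soon
    as it contains [z + e_0] and [z + e_r]. Both sides of the equivalence say
    that [Tstar] is saturated.

    For the Buchsbaum property, let the hull of [T] consist of the [t] such that
    [t + k e_0] and [t + k e_r] lie in [T] for some [k]; it indexes the monomials
    of the Cohen-Macaulay extension of the ring, and its part outside [T] those
    of the first local cohomology. In terms of fractions of polynomials: if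
    [f_0, f_1] is a system of parameters and [y f_1 = c f_0], then
    [w = y / f_0 = c / f_1] multiplies both parameters
    into the local ring, hence also powers of [u^N] and of [v^N]; as these are
    coprime, [w] is up to a unit a polynomial supported in the hull
    ([multiplier_in_hull]). So the local ring is Buchsbaum if the hull is
    carried into [T] by every nonzero element of [T]. The converse comes from
    the systems of parameters [u^(kN), v^(kN)], and together they give
    [local_ring_Buchsbaum]. Removing one [e_0] or [e_r] at a time turns the
    condition on the hull into saturation of [Tstar] ([hull_saturated]).

    The definition of systems of parameters refers to the Krull dimension, so
    one has to know that the local ring has dimension 2. A chain of three primes
    is given by the kernels of the identity, of [v := 0] and of the evaluation at
    the origin. For the upper bound, elements chosen in the successive steps of
    a chain of primes are algebraically independent over [K]
    ([prime_chain_independent]), while counting monomials shows that any three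
    polynomials in [u, v] are algebraically dependent ([algebraic_dependence]).

    For the Groebner basis, the toric ideal is handled through binomials with
    equal images. As [x_0] is the smallest variable, of two monomials with the
    same image the smaller one contains [x_0] to at least as high a power. Let
    [a] and [b] be monomials with images [z + e_0] and [z + e_r]. If [x_0]
    divides [a], then [z] is in the semigroup; otherwise [x_(s+1) a] is the
    leading monomial of the binomial [x_(s+1) a - x_0 b], and if the leading
    monomials of the basis avoid [x_(s+1)], then [a] itself can be reduced, and
    this stops only when [x_0] divides it. Conversely, with saturation a leading
    monomial divisible by [x_0] or [x_(s+1)] has a proper divisor that is a
    leading monomial too, which reducedness of the basis excludes
    ([groebner_saturated]). *)

(** * Monomials in u and v *)

Definition mon (x : nat * nat) : 'X_{1..2} :=
  (U_(ord0) *+ x.1 + U_(ord_max) *+ x.2)%MM.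

Definition expo (m : 'X_{1..2}) : nat * nat := (m ord0, m ord_max).

Lemma I2_cases (i : 'I_2) : i = ord0 \/ i = ord_max.
Proof. by case: i => [[|[|]]] // ?; [left|right]; apply: val_inj. Qed.

Lemma monK : cancel mon expo.
Proof.
case=> a b; rewrite /expo /mon !mnmDE !mulmnE !mnm1E /=.
by congr pair; rewrite ?mul0n ?mul1n ?addn0 ?mulnbl; lia.
Qed.

Lemma expoK : cancel expo mon.
Proof.
move=> m; apply/mnmP=> i; rewrite /mon mnmDE !mulmnE !mnm1E /=.
by case: (I2_cases i) => -> /=; lia.
Qed.

Lemma expoD m m' : expo (m + m')%MM = expo m + expo m'.
Proof. by rewrite /expo !mnmDE. Qed.

Lemma monD x y : mon (x + y) = (mon x + mon y)%MM.
Proof. by apply: (can_inj expoK); rewrite expoD !monK. Qed.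

Lemma mon0 : mon 0 = 0%MM.
Proof. by apply: (can_inj expoK); rewrite monK /expo !mnm0E. Qed.

Lemma monMn x k : mon (x *+ k) = (mon x *+ k)%MM.
Proof.
elim: k => [|k IHk]; first by rewrite mulr0n mon0 mulm0n.
by rewrite mulrS monD IHk mulmS.
Qed.

Lemma nat_pair_eq (x y : nat * nat) : x.1 = y.1 -> x.2 = y.2 -> x = y.
Proof. by case: x y => [? ?] [? ?] /= -> ->. Qed.

Lemma pair_mulrn (a b k : nat) : ((a, b) *+ k : nat * nat) = ((a * k)%N, (b * k)%N).
Proof. by elim: k => [|k IHk]; rewrite ?muln0 // mulrS IHk !mulnS. Qed.

(** * Toric ideals *)

Section Toric.
Variables (K : fieldType) (k : nat) (g : 'I_k -> nat * nat).

(** The degree of a monomial for the grading by the plane: the exponent of its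
    image under the monomial map. *)
Definition wt (m : 'X_{1..k}) : nat * nat := \sum_i g i *+ m i.

Lemma wtD m m' : wt (m + m')%MM = wt m + wt m'.
Proof. by rewrite /wt -big_split; apply: eq_bigr => i _; rewrite mnmDE mulrnDr. Qed.

Lemma wt0 : wt 0%MM = 0.
Proof. by rewrite /wt big1 // => i _; rewrite mnm0E. Qed.

Lemma wtMn m c : wt (m *+ c)%MM = wt m *+ c.
Proof.
by elim: c => [|c IHc]; rewrite ?mulm0n ?wt0 // mulmS wtD IHc mulrS.
Qed.

Lemma wtU j : wt U_(j)%MM = g j.
Proof.
rewrite /wt (bigD1 j) //= mnm1E eqxx mulr1n big1 ?addr0 // => i nij.
by rewrite mnm1E eq_sym (negPf nij) mulr0n.
Qed.

Lemma uvE x : uv K x = 'X_[mon x].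
Proof. by rewrite /uv /mon mpolyXD !mpolyXn. Qed.

Lemma phiE (p : {mpoly K[k]}) :
  phi g p = \sum_(m <- msupp p) p@_m *: 'X_[mon (wt m)].
Proof.
rewrite /phi comp_mpolyE; apply: eq_bigr => m _; congr (_ *: _).
rewrite /wt (big_morph mon monD mon0) (big_morph _ (mpolyXD K) (mpolyX0 _ _)).
by apply: eq_bigr => i _; rewrite tnth_mktuple uvE monMn mpolyXn.
Qed.

Lemma phiX m : phi g ('X_[m] : {mpoly K[k]}) = 'X_[mon (wt m)].
Proof. by rewrite phiE msuppX big_seq1 mcoeffX eqxx scale1r. Qed.

Lemma phiB : {morph @phi K k g : p q / p - q}.
Proof. by move=> p q; rewrite /phi comp_mpolyB. Qed.

Lemma toric_binomial a b : wt a = wt b ->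
  toric_ideal g ('X_[a] - 'X_[b] : {mpoly K[k]}).
Proof. by move=> ab; rewrite /toric_ideal phiB !phiX ab subrr. Qed.

(** The coefficient of the monomial of exponent [wt m] in the image of [f] is
    the sum of the coefficients of [f] over the fibre of [m]; it cannot vanish
    with a single nonzero term. *)
Lemma toric_companion (f : {mpoly K[k]}) m :
  toric_ideal g f -> m \in msupp f ->
  exists m', [/\ m' \in msupp f, m' != m & wt m' = wt m].
Proof.
move=> fI mf; apply: NNPP => noc.
have /(congr1 (mcoeff (mon (wt m)))) : phi g f = 0 by [].
rewrite phiE mcoeff0 raddf_sum (bigD1_seq m) ?msupp_uniq //=.
rewrite mcoeffZ mcoeffX eqxx mulr1 big_seq_cond big1 ?addr0; last first.
  move=> m' /andP[m'f nm]; rewrite mcoeffZ mcoeffX.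
  case: eqP => [/(can_inj monK) e|]; last by rewrite mulr0.
  by case: noc; exists m'.
by move/eqP; rewrite mcoeff_eq0 mf.
Qed.

End Toric.

(** * The monomial order *)

Section Order.
Variables (s : nat) (g : 'I_s.+2 -> nat * nat).
Local Notation lt := (degrevlex g).
Implicit Types (a b c m : 'X_{1..s.+2}).

(** The position of a variable in the order [x_0 < x_(s+1) < x_s < ... < x_1]. *)
Definition var_rank (i : 'I_s.+2) : nat := (if i == ord0 then 0 else s.+2 - i)%N.

Lemma var_ltE i j : var_lt i j = (var_rank i < var_rank j)%N.
Proof.
rewrite /var_lt /var_rank -!val_eqE /=; have := ltn_ord i; have := ltn_ord j.
by case: eqP; case: eqP => /=; lia.
Qed.

Lemma var_rank_inj : injective var_rank.
Proof.
move=> i j; rewrite /var_rank -!val_eqE /= => h; apply: val_inj => /=.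
by move: h (ltn_ord i) (ltn_ord j); case: eqP; case: eqP => /=; lia.
Qed.

Lemma gdegE m : gdeg g m = ((wt g m).1 + (wt g m).2)%N.
Proof.
rewrite /gdeg /wt (big_morph fst (id1 := 0%N) (op1 := addn)) //.
rewrite (big_morph snd (id1 := 0%N) (op1 := addn)) // -big_split /=.
apply: eq_bigr => i _.
by case: (g i) => a b; rewrite pair_mulrn mulnDl.
Qed.

Lemma degrevlexD c a b : lt (a + c)%MM (b + c)%MM <-> lt a b.
Proof.
rewrite /degrevlex !gdegE !wtD /=; split; (case=> [?|[? [i [hi hj]]]]; [left; lia|right]);
  (split; [lia|exists i; split; [move: hi; rewrite !mnmDE; lia|]]) => j /hj;
  rewrite !mnmDE; lia.
Qed.

Lemma degrevlex_trans b a c : lt a b -> lt b c -> lt a c.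
Proof.
case=> [ab|[dab [i [hi Hi]]]] [bc|[dbc [j [hj Hj]]]]; try (left; lia).
right; split; first lia.
case: (ltngtP (var_rank i) (var_rank j)) => [ij|ji|/var_rank_inj ij].
- exists i; rewrite -Hj ?var_ltE //; split=> // l li.
  by rewrite Hi // Hj // var_ltE; move: li; rewrite var_ltE => li; apply: ltn_trans ij.
- exists j; rewrite Hi ?var_ltE //; split=> // l lj.
  by rewrite Hi ?Hj // var_ltE; move: lj; rewrite var_ltE => lj; apply: ltn_trans ji.
- exists i; split=> [|l li]; first by rewrite -ij in hj; lia.
  by rewrite Hi // Hj // -ij.
Qed.

Lemma degrevlex_irr a : ~ lt a a.
Proof. by case=> [|[_ [i [+ _]]]]; lia. Qed.

(** The exponent of the smallest variable decides first, a higher one making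
    the monomial smaller. *)
Lemma degrevlex_x0 a b : gdeg g a = gdeg g b -> (b ord0 < a ord0)%N -> lt a b.
Proof.
by move=> d h; right; split=> //; exists ord0; split=> // j; rewrite var_ltE.
Qed.

Lemma degrevlex_le_x0 a b : gdeg g a = gdeg g b -> lt a b -> (b ord0 <= a ord0)%N.
Proof.
move=> d [|[_ [i [hi Hi]]]]; first lia.
case: (eqVneq i ord0) => [<-|ni0]; first lia.
by rewrite Hi // /var_lt ni0.
Qed.

(** [x_(s+1)] is the next variable to decide. *)
Lemma degrevlex_le_xlast a b : gdeg g a = gdeg g b -> a ord0 = b ord0 ->
  lt a b -> (b ord_max <= a ord_max)%N.
Proof.
move=> d e [|[_ [i [hi Hi]]]]; first lia.
case: (eqVneq i ord_max) => [<-|nim]; first lia.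
case: (eqVneq i ord0) => [i0|ni0]; first by move: hi; rewrite i0; lia.
rewrite Hi // var_ltE /var_rank (negPf ni0) /=.
by move: nim ni0 (ltn_ord i); rewrite -!val_eqE /=; lia.
Qed.

Lemma lead_mon_uniq (K : fieldType) (p : {mpoly K[s.+2]}) a b :
  is_lead_mon lt p a -> is_lead_mon lt p b -> a = b.
Proof.
move=> [sa ha] [sb hb]; apply/eqP/negPn/negP => nab.
apply: (@degrevlex_irr a); apply: (@degrevlex_trans b).
  exact: hb.
by apply: ha; rewrite // eq_sym.
Qed.

Lemma lead_mon_binomial (K : fieldType) a b : lt b a ->
  is_lead_mon lt ('X_[a] - 'X_[b] : {mpoly K[s.+2]}) a.
Proof.
move=> ba; have nab : a != b by apply/eqP => e; rewrite e in ba; apply: degrevlex_irr ba.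
split.
  by rewrite mcoeff_msupp mcoeffB !mcoeffX eqxx [b == a]eq_sym (negPf nab) subr0 oner_eq0.
move=> m /msuppB_le; rewrite mem_cat !msuppX !inE => /orP[/eqP->|/eqP->//].
by rewrite eqxx.
Qed.

End Order.

(** The minimal candidate need not lie in the list: whenever a candidate of the
    list is below the current one, it takes its place. *)
Lemma exists_minimal (A : eqType) (lt : A -> A -> Prop) (P : A -> Prop)
    (xs : seq A) x0 :
  (forall x, ~ lt x x) -> (forall y x z, lt x y -> lt y z -> lt x z) -> P x0 ->
  exists2 x, P x & forall y, y \in xs -> P y -> ~ lt y x.
Proof.
move=> irr tr Px0; elim: xs => [|y xs [x Px minx]]; first by exists x0.
have [[Py yx]|nyx] := classic (P y /\ lt y x).
  exists y => // z; rewrite inE => /orP[/eqP-> _|zxs Pz zy]; first exact: irr.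
  by apply: (minx z) => //; apply: tr yx.
by exists x => // z; rewrite inE => /orP[/eqP-> Py yx|]; [apply: nyx|apply: minx].
Qed.

(** * Reduced Groebner bases and saturation *)

Lemma toZ2D x y : toZ2 (x + y) = toZ2 x + toZ2 y.
Proof. by congr pair => /=; rewrite PoszD. Qed.

Lemma toZ2_inj : injective toZ2.
Proof. by move=> [a b] [c d] [-> ->]. Qed.

Lemma toZ2Mn x k : toZ2 (x *+ k) = toZ2 x *+ k.
Proof. by elim: k => // k IHk; rewrite !mulrS toZ2D IHk. Qed.

Definition saturated (a b : nat * nat) (P : int * int -> Prop) : Prop :=
  forall z, P (z + toZ2 a) -> P (z + toZ2 b) -> P z.

Section Groebner.
Variables (K : fieldType) (s : nat) (g : 'I_s.+2 -> nat * nat).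
Hypothesis g_neq0 : forall j, g j <> 0.
Local Notation lt := (degrevlex g).
Local Notation I := (@toric_ideal K _ g).
Local Notation S := (generated (fun j => toZ2 (g j))).

Lemma generated_wt z : S z <-> exists m, z = toZ2 (wt g m).
Proof.
have wtE m : toZ2 (wt g m) = \sum_j toZ2 (g j) *+ m j.
  rewrite /wt (big_morph _ toZ2D (erefl : toZ2 0 = 0)).
  by apply: eq_bigr => j _; rewrite toZ2Mn.
split=> [[c ->]|[m ->]]; last by exists m.
by exists [multinom c j | j < s.+2]; rewrite wtE; apply: eq_bigr => j _; rewrite mnmE.
Qed.

Lemma exponent_le_gdeg (m : 'X_{1..s.+2}) j : (m j <= gdeg g m)%N.
Proof.
rewrite /gdeg (bigD1 j) //=; apply: leq_trans (leq_addr _ _).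
by have := @g_neq0 j; case: (g j) => [[|a] [|b]] //= _; rewrite ?addSn ?addnS mulSn leq_addr.
Qed.

(** As no generator is zero, fibres of the monomial map are finite, so that
    reduction inside a fibre terminates. *)
Lemma fibre_minimal m : exists2 a, wt g a = wt g m &
  forall b, wt g b = wt g m -> ~ lt b a.
Proof.
pose d := (s.+2 * (gdeg g m)).+1.
pose xs := [seq bmnm x | x : 'X_{1..s.+2 < d}].
have [a wa mina] := exists_minimal (P := fun a => wt g a = wt g m) xs
  (@degrevlex_irr _ g) (@degrevlex_trans _ g) (erefl (wt g m)).
exists a => // b wb; apply: mina => //.
have bd : (mdeg b < d)%N.
  rewrite /d ltnS mdegE -[X in (X * _)%N]card_ord -sum_nat_const leq_sum // => j _.
  by rewrite (_ : gdeg g m = gdeg g b) ?exponent_le_gdeg // !gdegE wb.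
by apply/imageP; exists (BMultinom bd).
Qed.

Variable G : seq {mpoly K[s.+2]}.
Hypothesis hG : reduced_groebner_basis lt I G.

(** A basis element whose leading monomial divides [a], hence [m], would reduce
    [f] unless it is [f] itself. *)
Lemma reduced_lead f m p a : f \in G -> is_lead_mon lt f m ->
  I p -> is_lead_mon lt p a -> (a <= m)%MM -> a = m.
Proof.
case: hG => [[_ gb] _ _ red] fG fm pI pa am.
have [q [mq [qG qmq mqa]]] := gb p a pI pa.
have mqm := lepm_trans mqa am.
case: (eqVneq f q) => [fq|nfq]; last first.
  by have := red f q m mq fG qG nfq fm.1 qmq; rewrite mqm.
rewrite -fq in qmq; have mqE := lead_mon_uniq qmq fm.
apply/mnmP=> i; apply/eqP; rewrite eqn_leq; apply/andP; split; first exact: (mnm_lepP am).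
by rewrite -mqE; apply: (mnm_lepP mqa).
Qed.

Lemma lead_companion f m : I f -> is_lead_mon lt f m ->
  exists2 m', wt g m' = wt g m & lt m' m.
Proof.
move=> fI [mf hm]; have [m' [m'f nm w]] := toric_companion fI mf.
by exists m' => //; apply: hm.
Qed.

(** A variable that divides [m] and [m'] can be cancelled, because the degrees
    live in a group and the order is compatible with multiplication; the quotient
    of [m] would be a leading monomial properly dividing [m]. *)
Lemma reduced_lead_div f m m' j : f \in G -> is_lead_mon lt f m ->
  wt g m' = wt g m -> lt m' m -> (0 < m j)%N -> (0 < m' j)%N -> False.
Proof.
move=> fG fm w ltm mj m'j.
have U (x : 'X_{1..s.+2}) : (0 < x j)%N -> x = (x - U_(j) + U_(j))%MM.
  move=> xj; rewrite submK //; apply/mnm_lepP=> i; rewrite mnm1E.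
  by case: eqP => [<-|].
have lta : lt (m' - U_(j))%MM (m - U_(j))%MM.
  by apply/(degrevlexD g U_(j)); rewrite -!U.
have wE : wt g (m - U_(j))%MM = wt g (m' - U_(j))%MM.
  apply: toZ2_inj; apply: (addIr (toZ2 (g j))).
  by rewrite -!toZ2D -(wtU g j) -!wtD -(U m mj) -(U m' m'j) w.
have := reduced_lead fG fm (toric_binomial K wE) (lead_mon_binomial K lta) (lem_subr _ _).
by move/mnmP/(_ j); rewrite mnmBE mnm1E eqxx; lia.
Qed.

Lemma mnm1_le (m : 'X_{1..s.+2}) j : (U_(j) <= m)%MM = (0 < m j)%N.
Proof.
apply/mnm_lepP/idP => [/(_ j)|mj i]; first by rewrite mnm1E eqxx.
by rewrite mnm1E; case: eqP => [<-|].
Qed.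

(** Saturation fails exactly when some [a], prime to [x_0], has the property that
    [x_(s+1) a] but not [a] can be rewritten as a multiple of [x_0]. If [a] is the
    smallest monomial of its fibre, a basis element reducing [x_(s+1) a] has a
    leading monomial divisible by [x_(s+1)]. *)
Lemma groebner_saturated :
  (forall f m, f \in G -> is_lead_mon lt f m ->
     ~~ (U_(ord0) <= m)%MM /\ ~~ (U_(ord_max) <= m)%MM) <->
  saturated (g ord0) (g ord_max) S.
Proof.
case: (hG) => [[GI gb] _ _ red]; split.
- move=> nodiv z /generated_wt[a0 az] /generated_wt[b bz].
  (* Choosing the smallest representation [a] of [z + e_0] forces [x_0] into it. *)
  have [a wa mina] := fibre_minimal a0; rewrite -wa in az.
  apply/generated_wt.
  have wab : wt g (a + U_(ord_max))%MM = wt g (b + U_(ord0))%MM.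
    by apply: toZ2_inj; rewrite !wtD !wtU !toZ2D -az -bz addrAC.
  case: (posnP (a ord0)) => [a00|a0p]; last first.
    exists (a - U_(ord0))%MM; apply: (addIr (toZ2 (g ord0))).
    by rewrite az -(wtU g ord0) -toZ2D -wtD submK // mnm1_le.
  exfalso.
  have gd : gdeg g (b + U_(ord0))%MM = gdeg g (a + U_(ord_max))%MM by rewrite !gdegE wab.
  have ltb : lt (b + U_(ord0))%MM (a + U_(ord_max))%MM.
    by apply: degrevlex_x0 => //; rewrite !mnmDE !mnm1E a00 /= addn1.
  have [q [mq [qG qmq mqa]]] := gb _ _ (toric_binomial K wab) (lead_mon_binomial K ltb).
  have [_] := nodiv _ _ qG qmq; rewrite mnm1_le -eqn0Ngt => /eqP mq0.
  have {}mqa : (mq <= a)%MM.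
    apply/mnm_lepP => i; have := (mnm_lepP mqa) i; rewrite mnmDE mnm1E.
    by case: eqP => [<-|_]; rewrite ?mq0 ?addn0.
  have [m' w' lt'] := lead_companion (GI q qG).1 qmq.
  have aE : a = (mq + (a - mq))%MM by rewrite addmC submK.
  apply: (mina (m' + (a - mq))%MM); first by rewrite -wa [in RHS]aE !wtD w'.
  by rewrite [X in lt _ X]aE; apply/degrevlexD.
- move=> sat f m fG fm; rewrite !mnm1_le -!eqn0Ngt.
  have [fI _] := GI f fG.
  have [m' w ltm] := lead_companion fI fm.
  have gd : gdeg g m' = gdeg g m by rewrite !gdegE w.
  have m0 : m ord0 = 0%N.
    apply/eqP; rewrite eqn0Ngt; apply/negP => m0.
    by apply: (reduced_lead_div fG fm w ltm m0); have := degrevlex_le_x0 gd ltm; lia.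
  rewrite m0; split=> //; rewrite eqn0Ngt; apply/negP => ml.
  case: (posnP (m' ord0)) => [m'0|m'0].
    apply: (reduced_lead_div fG fm w ltm ml).
    by have := degrevlex_le_xlast gd _ ltm; rewrite m'0 m0 => /(_ erefl); lia.
  have lm0 : (U_(ord_max) <= m)%MM by rewrite mnm1_le.
  have lm'0 : (U_(ord0) <= m')%MM by rewrite mnm1_le.
  (* Now [m = x_(s+1) a] and [m' = x_0 b], so the element [z] with
     [z + e_0 = deg a] and [z + e_r = deg b] belongs to the semigroup. *)
  pose a := (m - U_(ord_max))%MM; pose b := (m' - U_(ord0))%MM.
  have wab : wt g a + g ord_max = wt g b + g ord0.
    by rewrite -!wtU -!wtD !submK.
  have [c cE] : exists c, toZ2 (wt g a) - toZ2 (g ord0) = toZ2 (wt g c).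
    apply/generated_wt/sat; apply/generated_wt; first by exists a; rewrite subrK.
    by exists b; rewrite addrAC -toZ2D wab toZ2D addrK.
  have wac : wt g a = wt g (c + U_(ord0))%MM.
    by apply: toZ2_inj; rewrite wtD toZ2D -cE wtU subrK.
  have ltc : lt (c + U_(ord0))%MM a.
    apply: degrevlex_x0; first by rewrite !gdegE wac.
    by rewrite mnmBE m0 mnmDE !mnm1E eqxx addn1.
  have := reduced_lead fG fm (toric_binomial K wac) (lead_mon_binomial K ltc) (lem_subr _ _).
  by move/mnmP/(_ ord_max); rewrite mnmBE mnm1E eqxx; lia.
Qed.

End Groebner.

(** * Three polynomials in two variables are algebraically dependent *)

Lemma linear_dependence (K : fieldType) (I J : finType) (F : I -> J -> K) :
  (#|J| < #|I|)%N ->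
  exists2 c : I -> K, exists i, c i != 0 & forall j, \sum_i c i * F i j = 0.
Proof.
move=> JI; pose A := \matrix_(i < #|I|, j < #|J|) F (enum_val i) (enum_val j).
have kA : kermx A != 0.
  rewrite -mxrank_eq0 mxrank_ker -lt0n subn_gt0.
  exact: leq_ltn_trans (rank_leq_col A) JI.
pose w := nz_row (kermx A).
have w0 : w != 0 by rewrite nz_row_eq0.
have wA : w *m A = 0 by apply/sub_kermxP/nz_row_sub.
exists (fun i => w 0 (enum_rank i)).
  have /rV0Pn[i wi] := w0; exists (enum_val i); by rewrite enum_valK.
move=> j; have /rowP/(_ (enum_rank j)) := wA; rewrite !mxE => {2}<-.
rewrite (reindex (@enum_val I predT)) /=; last exact/onW_bij/enum_val_bij.
by apply: eq_bigr => i _; rewrite !mxE enum_valK enum_rankK.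
Qed.

Lemma msupp_mul_split (k : nat) (K : fieldType) (p q : {mpoly K[k]}) m :
  m \in msupp (p * q) ->
  exists m1 m2, [/\ m1 \in msupp p, m2 \in msupp q & m = (m1 + m2)%MM].
Proof.
by move=> /msuppM_le/allpairsP[[m1 m2] /= [? ? ->]]; exists m1, m2.
Qed.

Lemma mdeg_msuppX (k : nat) (K : fieldType) (p : {mpoly K[k]}) D i m :
  (forall m, m \in msupp p -> mdeg m <= D)%N -> m \in msupp (p ^+ i) ->
  (mdeg m <= i * D)%N.
Proof.
move=> pD; elim: i m => [|i IHi] m.
  by rewrite expr0 msupp1 inE => /eqP->; rewrite mdeg0.
rewrite exprS => /msupp_mul_split[m1 [m2 [/pD h1 /IHi h2 ->]]].
by rewrite mdegD mulSn leq_add.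
Qed.

(** The products of powers of three polynomials with exponents below [M] number
    [M ^ 3], while they live in a space whose dimension grows like [M ^ 2]. *)
Lemma algebraic_dependence (K : fieldType) (p0 p1 p2 : {mpoly K[2]}) :
  exists M (c : nat -> nat -> nat -> K),
    (exists i j k, [/\ (i < M)%N, (j < M)%N, (k < M)%N & c i j k != 0]) /\
    \sum_(i < M) \sum_(j < M) \sum_(k < M)
       c i j k *: (p0 ^+ i * p1 ^+ j * p2 ^+ k) = 0.
Proof.
pose D := (msize p0 + msize p1 + msize p2).+1.
have pD p m : p \in [:: p0; p1; p2] -> m \in msupp p -> (mdeg m <= D)%N.
  rewrite !inE /D => /or3P[]/eqP-> /msize_mdeg_lt; lia.
(* [M] is chosen so that [(3 M D)^2 < M^3]. *)
pose M := (9 * D * D).+1; pose E := (3 * M * D)%N.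
pose P (x : 'I_M * 'I_M * 'I_M) := p0 ^+ x.1.1 * p1 ^+ x.1.2 * p2 ^+ x.2.
have PE x m : m \in msupp (P x) -> (m ord0 < E)%N /\ (m ord_max < E)%N.
  move=> /msupp_mul_split[m12 [m3 [/msupp_mul_split[m1 [m2 [h1 h2 ->]]] h3 ->]]].
  have d1 := mdeg_msuppX (fun m => pD p0 m (mem_head _ _)) h1.
  have d2 : (mdeg m2 <= x.1.2 * D)%N.
    by apply: mdeg_msuppX h2 => m'; apply: pD; rewrite !inE eqxx orbT.
  have d3 : (mdeg m3 <= x.2 * D)%N.
    by apply: mdeg_msuppX h3 => m'; apply: pD; rewrite !inE eqxx !orbT.
  have d : (mdeg (m1 + m2 + m3) < E)%N.
    have lex : ((x.1.1 + x.1.2 + x.2).+1 <= 3 * M)%N.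
      by have := ltn_ord x.1.1; have := ltn_ord x.1.2; have := ltn_ord x.2; lia.
    apply: leq_trans (leq_mul lex (leqnn D)).
    by rewrite !mdegD mulSn !mulnDl; move: d1 d2 d3; rewrite /D; lia.
  move: d; rewrite mdegE !big_ord_recl big_ord0.
  by rewrite (_ : lift ord0 ord0 = ord_max :> 'I_2); [lia|apply: val_inj].
have [|c [x cx] Hc] := @linear_dependence K _ ('I_E * 'I_E)%type
    (fun x y => (P x)@_(mon (val y.1, val y.2))).
  by rewrite !card_prod !card_ord /E /M; nia.
(* The coefficients are indexed by naturals rather than by ['I_M], with the
   value 0 out of range. *)
exists M, (fun i j k => if [pick x | [&& val x.1.1 == i, val x.1.2 == j & val x.2 == k]]
  is Some x then c x else 0).
have pickE (y : 'I_M * 'I_M * 'I_M) : [pick x : 'I_M * 'I_M * 'I_M |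
    [&& val x.1.1 == val y.1.1, val x.1.2 == val y.1.2 & val x.2 == val y.2]] = Some y.
  case: pickP => [[[a1 a2] a3] /and3P[/eqP/val_inj h1 /eqP/val_inj h2 /eqP/val_inj h3]|/(_ y)].
    by case: y h1 h2 h3 => [[? ?] ?] /= -> -> ->.
  by rewrite !eqxx.
split.
  exists x.1.1, x.1.2, x.2; split=> //.
  by rewrite (pickE x).
transitivity (\sum_(x : 'I_M * 'I_M * 'I_M) c x *: P x).
  by rewrite pair_bigA /= pair_bigA /=; apply: eq_bigr => x' _; rewrite (pickE x').
apply/mpolyP => m; rewrite raddf_sum mcoeff0.
case: (ltnP (m ord0) E) => [m0|m0]; last first.
  rewrite big1 // => y _; rewrite /= mcoeffZ [_@_m]memN_msupp_eq0 ?mulr0 //.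
  by apply/negP => /PE[]; lia.
case: (ltnP (m ord_max) E) => [m1|m1]; last first.
  rewrite big1 // => y _; rewrite /= mcoeffZ [_@_m]memN_msupp_eq0 ?mulr0 //.
  by apply/negP => /PE[]; lia.
rewrite -[RHS](Hc (Ordinal m0, Ordinal m1)); apply: eq_bigr => y _.
by rewrite /= mcoeffZ -/(expo m) expoK.
Qed.

(** * Prime chains *)

Section Subrings.
Variables (F : fieldType) (B : F -> Prop).

Definition is_subring : Prop :=
  [/\ B 1, forall x y, B x -> B y -> B (x - y)
    & forall x y, B x -> B y -> B (x * y)].

Hypothesis hB : is_subring.

Lemma subringB x y : B x -> B y -> B (x - y). Proof. by case: hB => _ + _; apply. Qed.
Lemma subringM x y : B x -> B y -> B (x * y). Proof. by case: hB => _ _; apply. Qed.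
Lemma subring1 : B 1. Proof. by case: hB. Qed.
Lemma subring0 : B 0. Proof. by rewrite -(subrr 1); apply: subringB subring1 subring1. Qed.
Lemma subringN x : B x -> B (- x).
Proof. by move=> Bx; rewrite -sub0r; apply: subringB subring0 Bx. Qed.
Lemma subringD x y : B x -> B y -> B (x + y).
Proof. by move=> Bx By; rewrite -(opprK y); apply/subringB/subringN. Qed.
Lemma subringX x k : B x -> B (x ^+ k).
Proof.
move=> Bx; elim: k => [|k IHk]; first by rewrite expr0; apply: subring1.
by rewrite exprS; apply: subringM.
Qed.
Lemma subring_sum (I : Type) (r : seq I) (f : I -> F) :
  (forall i, B (f i)) -> B (\sum_(i <- r) f i).
Proof. by move=> Bf; apply: big_ind => //; [apply: subring0|apply: subringD]. Qed.

Lemma idealB I x y : is_ideal B I -> I x -> I y -> I (x - y).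
Proof.
case=> _ _ ID IM Ix Iy; apply: ID => //; rewrite -mulN1r; apply: IM => //.
exact/subringN/subring1.
Qed.

(** Cancelling [x] in a polynomial relation modulo a prime [Q], then reading
    the constant coefficient modulo a larger prime containing [x]: if the
    coefficients are known to vanish as soon as they lie in the larger prime,
    all of them vanish, one after the other. *)
Lemma prime_step Q Q' x (b : nat -> F) (Z : nat -> Prop) M :
  is_prime_ideal B Q -> is_prime_ideal B Q' -> (forall y, Q y -> Q' y) ->
  Q' x -> ~ Q x -> (forall i, B (b i)) -> (forall i, Z i -> b i = 0) ->
  (forall i, (i < M)%N -> Q' (b i) -> Z i) ->
  Q (\sum_(i < M) b i * x ^+ i) -> forall i, (i < M)%N -> Z i.
Proof.
move=> [_ _ Qp] [Q'i _ _] QQ' Q'x Qx.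
have Bx : B x by case: Q'i => h _ _ _; apply: h.
elim: M b Z => [//|M IHM] b Z Bb Zb Q'Z.
have -> : \sum_(i < M.+1) b i * x ^+ i = b 0%N + x * \sum_(i < M) b i.+1 * x ^+ i.
  rewrite big_ord_recl expr0 mulr1 mulr_sumr; congr (_ + _).
  by apply: eq_bigr => i _; rewrite exprS mulrCA.
set t := \sum_(i < M) _ => Qs.
have Bt : B t by apply: subring_sum => i; apply/subringM/subringX.
have Z0 : Z 0%N.
  apply: Q'Z => //; rewrite -[b 0%N](addrK (x * t)); apply: idealB => //; first exact: QQ'.
  by case: Q'i => _ _ _ h; rewrite mulrC; apply: h.
move: Qs; rewrite Zb // add0r => /(Qp _ _ Bx Bt)[//|Qt] [//|i].
apply: (IHM (fun i => b i.+1) (fun i => Z i.+1)) => // [j|j].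
  exact: Zb.
by move=> jM; apply: (Q'Z j.+1).
Qed.

Lemma prime_chain_sub d Q i : prime_chain B d Q -> (i < d)%N ->
  [/\ is_prime_ideal B (Q i), is_prime_ideal B (Q i.+1) & forall x, Q i x -> Q i.+1 x].
Proof. by case=> pr st id; case: (st i id) => ? _; split=> //; apply: pr; rewrite // ltnW. Qed.

(** Applying [prime_step] at each of the three inclusions peels off one variable
    of the relation; the scalars that remain lie in a proper ideal, so they are
    zero. *)
Lemma prime_chain_independent (K : fieldType) (f : {rmorphism K -> F}) d Q x0 x1 x2 M
    (c : nat -> nat -> nat -> K) :
  (forall a, B (f a)) -> prime_chain B d Q -> (3 <= d)%N ->
  Q 1%N x0 -> ~ Q 0%N x0 -> Q 2%N x1 -> ~ Q 1%N x1 -> Q 3%N x2 -> ~ Q 2%N x2 ->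
  \sum_(i < M) \sum_(j < M) \sum_(k < M) f (c i j k) * (x0 ^+ i * x1 ^+ j * x2 ^+ k) = 0 ->
  forall i j k, (i < M)%N -> (j < M)%N -> (k < M)%N -> c i j k = 0.
Proof.
move=> Bf ch d3 Q1x0 Q0x0 Q2x1 Q1x1 Q3x2 Q2x2 rel.
have [p0 p1 s01] := prime_chain_sub ch (ltnW (ltnW d3)).
have [_ p2 s12] := prime_chain_sub ch (ltnW d3).
have [_ p3 s23] := prime_chain_sub ch d3.
have Bx i x : is_prime_ideal B (Q i) -> Q i x -> B x.
  by case=> -[h _ _ _] _ _; apply: h.
have Bx0 := Bx _ _ p1 Q1x0; have Bx1 := Bx _ _ p2 Q2x1; have Bx2 := Bx _ _ p3 Q3x2.
pose b2 i j := \sum_(k < M) f (c i j k) * x2 ^+ k.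
pose b1 i := \sum_(j < M) b2 i j * x1 ^+ j.
have Bb2 i j : B (b2 i j) by apply: subring_sum => k; apply/subringM/subringX.
have Bb1 i : B (b1 i) by apply: subring_sum => j; apply/subringM/subringX.
have b2_0 i j : (forall k, (k < M)%N -> c i j k = 0) -> b2 i j = 0.
  by move=> h; rewrite /b2 big1 // => k _; rewrite h // rmorph0 mul0r.
have b1_0 i : (forall j k, (j < M)%N -> (k < M)%N -> c i j k = 0) -> b1 i = 0.
  by move=> h; rewrite /b1 big1 // => j _; rewrite b2_0 ?mul0r // => k; apply: h.
move=> i j k iM jM kM; move: i iM j k jM kM.
apply: (prime_step p0 p1 s01 Q1x0 Q0x0 Bb1) => // [i iM Q1b|]; last first.
  case: p0 => -[_ Q00 _ _] _ _; rewrite (_ : \sum_(i < M) _ = 0) // -[RHS]rel.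
  apply: eq_bigr => i _; rewrite mulr_suml; apply: eq_bigr => j _.
  rewrite !mulr_suml; apply: eq_bigr => k _.
  by rewrite -!mulrA; congr (_ * _); rewrite mulrC [x1 ^+ j * _]mulrC -mulrA.
move=> j k jM; move: j jM k.
apply: (prime_step p1 p2 s12 Q2x1 Q1x1 (Bb2 i)) => // [j|j jM Q2b]; first exact: b2_0.
apply: (prime_step p2 p3 s23 Q3x2 Q2x2 (b := fun k => f (c i j k))) => // [k ->|k kM Q3c].
  by rewrite rmorph0.
apply/eqP/negPn/negP => c0; case: p3 => -[_ _ _ QM] Q31 _; apply: Q31.
by rewrite -(rmorph1 f) -(mulVf c0) rmorphM; apply: QM.
Qed.

End Subrings.

(** * The local ring of a plane semigroup at the origin *)

Lemma ideal_span0 (F : fieldType) (B : F -> Prop) x :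
  B 0 -> ideal_span B [::] x <-> x = 0.
Proof.
move=> B0; split=> [[c [_ ->]]|->]; first by rewrite big_ord0.
by exists (fun _ => 0); rewrite big_ord0.
Qed.

Lemma ideal_span1 (F : fieldType) (B : F -> Prop) a x :
  ideal_span B [:: a] x <-> exists2 c, B c & x = c * a.
Proof.
split=> [[c [Bc ->]]|[c Bc ->]]; first by exists (c 0%N); rewrite ?big_ord1.
by exists (fun _ => c); rewrite big_ord1.
Qed.

Lemma ideal_span2 (F : fieldType) (B : F -> Prop) a b x :
  ideal_span B [:: a; b] x <-> exists c d, [/\ B c, B d & x = c * a + d * b].
Proof.
split=> [[c [Bc ->]]|[c [d [Bc Bd ->]]]].
  by exists (c 0%N), (c 1%N); rewrite big_ord_recl big_ord1.
exists (fun i => if i is 0%N then c else d); split; first by case.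
by rewrite big_ord_recl big_ord1.
Qed.

Local Notation "p %:F" := (@tofrac _ p).

Section SemigroupRing.
Variables (K : fieldType) (T : nat * nat -> Prop).
Local Notation F := {fraction {mpoly K[2]}}.
Implicit Types (p q : {mpoly K[2]}) (x y z w : F).

Definition semigroup_ring p : Prop := forall m, m \in msupp p -> T (expo m).

Hypotheses (T0 : T 0) (TD : forall s t, T s -> T t -> T (s + t)).

Lemma semigroup_ring0 : semigroup_ring 0. Proof. by move=> m; rewrite msupp0. Qed.

Lemma semigroup_ringD p q : semigroup_ring p -> semigroup_ring q -> semigroup_ring (p + q).
Proof. by move=> Rp Rq m /msuppD_le; rewrite mem_cat => /orP[/Rp|/Rq]. Qed.

Lemma semigroup_ringN p : semigroup_ring p -> semigroup_ring (- p).
Proof. by move=> Rp m; rewrite (perm_mem (msuppN p)) => /Rp. Qed.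

Lemma semigroup_ringZ a p : semigroup_ring p -> semigroup_ring (a *: p).
Proof. by move=> Rp m /msuppZ_le/Rp. Qed.

Lemma semigroup_ringM p q : semigroup_ring p -> semigroup_ring q -> semigroup_ring (p * q).
Proof. by move=> Rp Rq m /msupp_mul_split[m1 [m2 [/Rp ? /Rq ? ->]]]; rewrite expoD; apply: TD. Qed.

Lemma semigroup_ringX t : T t -> semigroup_ring 'X_[mon t].
Proof. by move=> Tt m; rewrite msuppX inE => /eqP->; rewrite monK. Qed.

Lemma semigroup_ring1 : semigroup_ring 1.
Proof. by rewrite -(mpolyX0 _ _) -mon0; apply: semigroup_ringX. Qed.

Lemma semigroup_ringC a : semigroup_ring a%:MP.
Proof. by rewrite -[_%:MP]mulr1 mul_mpolyC; apply/semigroup_ringZ/semigroup_ring1. Qed.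

Lemma semigroup_ringXn p k : semigroup_ring p -> semigroup_ring (p ^+ k).
Proof.
move=> Rp; elim: k => [|k IHk]; first by rewrite expr0; apply: semigroup_ring1.
by rewrite exprS; apply: semigroup_ringM.
Qed.

Lemma mpolyX_neq0 m : 'X_[m] != 0 :> {mpoly K[2]}.
Proof. by rewrite -msupp_eq0 msuppX. Qed.

Lemma mcoeff0_1_neq0 : (1 : {mpoly K[2]})@_0%MM != 0.
Proof. by rewrite mcoeff1 eqxx oner_eq0. Qed.

Lemma mcoeff0M p q : (p * q)@_0%MM = p@_0%MM * q@_0%MM.
Proof. exact: (rmorphM (mcoeff 0%MM)). Qed.

Lemma mcoeff0_neq0 q : q@_0%MM != 0 -> q != 0.
Proof. by apply: contraNneq => ->; rewrite mcoeff0. Qed.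

Lemma mcoeff0M_neq0 p q : p@_0%MM != 0 -> q@_0%MM != 0 -> (p * q)@_0%MM != 0.
Proof. by rewrite mcoeff0M; apply: mulf_neq0. Qed.

Lemma tofrac_neq0 q : q@_0%MM != 0 -> q%:F != 0.
Proof. by move/mcoeff0_neq0; rewrite tofrac_eq0. Qed.

Lemma mcoeff0_X t : t <> 0 -> ('X_[mon t] : {mpoly K[2]})@_0%MM = 0.
Proof.
move=> t0; rewrite mcoeffX; case: eqP => // e.
by case: t0; rewrite -(monK t) e -mon0 monK.
Qed.

Definition local_ring x : Prop :=
  exists p q, [/\ semigroup_ring p, semigroup_ring q, q@_0%MM != 0 & x = p%:F / q%:F].

Lemma local_ring_tofrac p : semigroup_ring p -> local_ring p%:F.
Proof.
by exists p, 1; rewrite tofrac1 divr1 mcoeff0_1_neq0; split=> //; apply: semigroup_ring1.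
Qed.

Lemma local_ring_inv q : semigroup_ring q -> q@_0%MM != 0 -> local_ring q%:F^-1.
Proof. by exists 1, q; rewrite tofrac1 mul1r; split=> //; apply: semigroup_ring1. Qed.

Lemma local_ring_subring : is_subring local_ring.
Proof.
split.
- by rewrite -tofrac1; apply/local_ring_tofrac/semigroup_ring1.
- move=> _ _ [p [q [Rp Rq q0 ->]]] [p' [q' [Rp' Rq' q'0 ->]]].
  exists (p * q' - p' * q), (q * q'); split; last 1 first.
  + by rewrite tofracB !tofracM -mulNr addf_div ?tofrac_neq0 // mulNr.
  + by apply: semigroup_ringD; [|apply: semigroup_ringN]; apply: semigroup_ringM.
  + exact: semigroup_ringM.
  + exact: mcoeff0M_neq0.
- move=> _ _ [p [q [Rp Rq q0 ->]]] [p' [q' [Rp' Rq' q'0 ->]]].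
  exists (p * p'), (q * q'); split; last by rewrite !tofracM mulf_div.
  + exact: semigroup_ringM.
  + exact: semigroup_ringM.
  + exact: mcoeff0M_neq0.
Qed.

Lemma frac_eq p q p' q' : q@_0%MM != 0 -> q'@_0%MM != 0 ->
  p%:F / q%:F = p'%:F / q'%:F -> p * q' = p' * q.
Proof.
move=> q0 q'0 /eqP; rewrite eqr_div ?tofrac_neq0 // -!tofracM tofrac_eq.
by move/eqP.
Qed.

Lemma nonunits_local_ringP x : nonunits local_ring x <->
  exists p q, [/\ semigroup_ring p, semigroup_ring q, q@_0%MM != 0, p@_0%MM = 0 & x = p%:F / q%:F].
Proof.
split=> [[[p [q [Rp Rq q0 ->]]] nu]|[p [q [Rp Rq q0 p0 ->]]]].
  exists p, q; split=> //; apply/eqP/negPn/negP => p0; apply: nu.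
  exists (q%:F / p%:F); first by exists q, p.
  by rewrite mulf_div [q%:F * _]mulrC divff ?mulf_neq0 ?tofrac_neq0.
split; first by exists p, q.
case=> _ [p' [q' [Rp' Rq' q'0 ->]]].
rewrite mulf_div -!tofracM => e.
have : (p * p')%:F / (q * q')%:F = 1%:F / 1%:F by rewrite e tofrac1 divr1.
move/(frac_eq (mcoeff0M_neq0 q0 q'0) mcoeff0_1_neq0)/(congr1 (mcoeff 0%MM))/eqP; rewrite mul1r mulr1.
by rewrite !mcoeff0M p0 mul0r eq_sym (negPf (mulf_neq0 q0 q'0)).
Qed.

(** The extension to the local ring of the kernel of a morphism to a domain; it
    is prime as soon as the kernel is contained in the maximal ideal. *)
Definition ext_ker (D : idomainType) (f : {rmorphism {mpoly K[2]} -> D}) x : Prop :=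
  exists p q, [/\ semigroup_ring p, semigroup_ring q, q@_0%MM != 0, f p = 0 & x = p%:F / q%:F].

Lemma ext_ker_prime (D : idomainType) (f : {rmorphism {mpoly K[2]} -> D}) :
  (forall q, f q = 0 -> q@_0%MM = 0) -> is_prime_ideal local_ring (ext_ker f).
Proof.
move=> f0; split; first split.
- by move=> x [p [q [Rp Rq q0 _ ->]]]; exists p, q.
- exists 0, 1; rewrite rmorph0 mcoeff1 eqxx oner_eq0 tofrac0 mul0r.
  by split=> //; [apply: semigroup_ring0|apply: semigroup_ring1].
- move=> _ _ [p [q [Rp Rq q0 fp ->]]] [p' [q' [Rp' Rq' q'0 fp' ->]]].
  exists (p * q' + p' * q), (q * q'); split.
  + by apply: semigroup_ringD; apply: semigroup_ringM.
  + exact: semigroup_ringM.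
  + exact: mcoeff0M_neq0.
  + by rewrite rmorphD !rmorphM fp fp' !mul0r addr0.
  + by rewrite tofracD !tofracM addf_div ?tofrac_neq0.
- move=> _ _ [p [q [Rp Rq q0 ->]]] [p' [q' [Rp' Rq' q'0 fp' ->]]].
  exists (p * p'), (q * q'); split; last by rewrite !tofracM mulf_div.
  + exact: semigroup_ringM.
  + exact: semigroup_ringM.
  + exact: mcoeff0M_neq0.
  + by rewrite rmorphM fp' mulr0.
- case=> p [q [_ _ q0 fp e]].
  have : 1%:F / 1%:F = p%:F / q%:F by rewrite -e tofrac1 divr1.
  move/(frac_eq mcoeff0_1_neq0 q0); rewrite mulr1 mul1r => qp.
  by move: q0; rewrite qp (f0 p fp) eqxx.
- move=> _ _ [p [q [Rp Rq q0 ->]]] [p' [q' [Rp' Rq' q'0 ->]]] [a [b [Ra Rb b0 fa]]].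
  rewrite mulf_div -!tofracM => /(frac_eq (mcoeff0M_neq0 q0 q'0) b0).
  move/(congr1 f); rewrite [in RHS]rmorphM fa mul0r !rmorphM => /eqP.
  rewrite !mulf_eq0 => /orP[/orP[]|] /eqP h.
  + by left; exists p, q.
  + by right; exists p', q'.
  + by move: b0; rewrite (f0 b h) eqxx.
Qed.

Lemma ext_ker_sub (D D' : idomainType) (f : {rmorphism {mpoly K[2]} -> D})
    (f' : {rmorphism {mpoly K[2]} -> D'}) :
  (forall p, f p = 0 -> f' p = 0) -> forall x, ext_ker f x -> ext_ker f' x.
Proof. by move=> h x [p [q [? ? ? /h ? ?]]]; exists p, q. Qed.

Lemma ext_ker_tofrac (D : idomainType) (f : {rmorphism {mpoly K[2]} -> D}) p :
  (forall q, f q = 0 -> q@_0%MM = 0) -> semigroup_ring p -> ext_ker f p%:F <-> f p = 0.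
Proof.
move=> f0 Rp; split=> [[a [q [Ra Rq q0 fa e]]]|fp].
  have : p%:F / 1%:F = a%:F / q%:F by rewrite -e tofrac1 divr1.
  move/(frac_eq mcoeff0_1_neq0 q0)/(congr1 f); rewrite mulr1.
  rewrite rmorphM fa => /eqP; rewrite mulf_eq0 => /orP[/eqP//|/eqP/f0 /eqP].
  by rewrite (negPf q0).
exists p, 1; rewrite tofrac1 divr1.
by split=> //; [|exact: mcoeff0_1_neq0]; apply: semigroup_ring1.
Qed.

(** The elements separating the members of a chain can be taken to be
    polynomials, as denominators are units; then three of them are both
    independent and dependent. *)
Lemma krull_dim_local_ring_le d Q : prime_chain local_ring d Q -> (d <= 2)%N.
Proof.
move=> ch; rewrite leqNgt; apply/negP => d3.
have pick_poly i : (i < d)%N -> exists p, Q i.+1 p%:F /\ ~ Q i p%:F.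
  case: ch => pr st id; case: (st i id) => _ [x Qx nQx].
  have [[[iB _ _ iM] _ _] [[_ _ _ jM] _ _]] := (pr i.+1 id, pr i (ltnW id)).
  have [p [q [Rp Rq q0 xE]]] := iB x Qx.
  exists p; split.
    by rewrite -[p%:F](divfK (tofrac_neq0 q0)) -xE mulrC; apply: iM => //; apply: local_ring_tofrac.
  by move=> Qp; apply: nQx; rewrite xE mulrC; apply: jM => //; apply: local_ring_inv.
have [p0 [Qp0 nQp0]] := pick_poly 0%N (ltnW (ltnW d3)).
have [p1 [Qp1 nQp1]] := pick_poly 1%N (ltnW d3).
have [p2 [Qp2 nQp2]] := pick_poly 2%N d3.
have [M [c [[i [j [k [iM jM kM cn]]]] rel]]] := algebraic_dependence p0 p1 p2.
have := prime_chain_independent local_ring_subring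
  (f := @tofrac {mpoly K[2]} \o @mpolyC 2 K) (M := M) (c := c) _ ch d3 Qp0 nQp0 Qp1 nQp1 Qp2 nQp2.
move=> H; move: cn; rewrite H ?eqxx //.
  by move=> a; apply/local_ring_tofrac/semigroup_ringC.
rewrite -[RHS]tofrac0 -rel raddf_sum; apply: eq_bigr => i' _.
rewrite raddf_sum; apply: eq_bigr => j' _; rewrite raddf_sum; apply: eq_bigr => k' _.
by rewrite -mul_mpolyC /= !tofracM !tofracXn.
Qed.

Variable N : nat.
Hypothesis N_gt0 : (0 < N)%N.
Local Notation e0 := ((N, 0%N) : nat * nat).
Local Notation e1 := ((0%N, N) : nat * nat).
Hypotheses (Te0 : T e0) (Te1 : T e1).

Lemma TMn t k : T t -> T (t *+ k).
Proof.
by move=> Tt; elim: k => [|k IHk]; rewrite ?mulr0n // mulrS; apply: TD.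
Qed.

Definition v_to_0 : {rmorphism {mpoly K[2]} -> {mpoly K[2]}} :=
  comp_mpoly [tuple 'X_ord0; 0].

Lemma v_to_0X m : v_to_0 'X_[m] = 'X_ord0 ^+ m ord0 * 0 ^+ m ord_max.
Proof.
rewrite /= comp_mpolyX !big_ord_recl big_ord0 mulr1 /=; congr (_ * _ ^+ m _).
exact: val_inj.
Qed.

Lemma mcoeff0_v_to_0 p : (v_to_0 p)@_0%MM = p@_0%MM.
Proof.
rewrite [RHS](congr1 (mcoeff 0%MM) (mpolyE p)) /v_to_0 /= comp_mpolyE.
rewrite !(raddf_sum (mcoeff 0%MM)); apply: eq_bigr => m _; rewrite /= !mcoeffZ; congr (_ * _).
rewrite -comp_mpolyX -/(v_to_0 'X_[m]) v_to_0X mcoeff0M !(rmorphXn (mcoeff 0%MM)) /= !mcoeffX mcoeff0.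
rewrite mnm1_eq0 !expr0n -natrM mulnb -(inj_eq (can_inj expoK)) /expo.
by rewrite !mnm0E xpair_eqE.
Qed.

Lemma krull_dim_local_ring2 : krull_dim local_ring 2.
Proof.
split; last exact: krull_dim_local_ring_le.
have f0 (p : {mpoly K[2]}) : idfun p = 0 -> p@_0%MM = 0 by move=> /= ->; rewrite mcoeff0.
have f1 p : v_to_0 p = 0 -> p@_0%MM = 0.
  by move=> h; rewrite -mcoeff0_v_to_0 h mcoeff0.
exists (fun i => match i with
  | 0%N => ext_ker (idfun : {rmorphism {mpoly K[2]} -> {mpoly K[2]}})
  | 1%N => ext_ker v_to_0
  | _ => ext_ker (mcoeff 0%MM) end); split.
  by case=> [|[|i]] _; apply: ext_ker_prime.
case=> [|[|//]] _; split.
- by apply: ext_ker_sub => p /= ->; rewrite comp_mpoly0.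
- exists ('X_[mon e1])%:F.
    apply/ext_ker_tofrac => //; first exact: semigroup_ringX.
    have [_ m1] := monK e1.
    by rewrite v_to_0X m1 expr0n gtn_eqF ?mulr0.
  move/ext_ker_tofrac => /(_ f0 (semigroup_ringX Te1)) /= /eqP.
  by rewrite (negPf (mpolyX_neq0 _)).
- exact: ext_ker_sub.
- exists ('X_[mon e0])%:F.
    apply/ext_ker_tofrac => //; first exact: semigroup_ringX.
    by rewrite /= mcoeff0_X // => -[]; lia.
  move/ext_ker_tofrac => /(_ f1 (semigroup_ringX Te0)) /eqP.
  have [m0 m1] := monK e0; rewrite v_to_0X m0 m1 expr0 mulr1.
  by rewrite expf_eq0 (negPf (mpolyX_neq0 _)) andbF.
Qed.

Lemma krull_dim_local_ringE d : krull_dim local_ring d -> d = 2.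
Proof.
have [[Q' ch'] _] := krull_dim_local_ring2.
by case=> -[Q ch] /(_ 2 Q' ch'); have := krull_dim_local_ring_le ch; lia.
Qed.

(** This holds when the convex cone of [T] is spanned by [e0] and [e1] and [T] is
    finitely generated; it makes every [u^(kN), v^(kN)] a system of parameters. *)
Hypothesis Tbig : forall k, exists D, forall t, T t -> (D <= t.1 + t.2)%N ->
  (exists2 t', T t' & t = e0 *+ k + t') \/
  (exists2 t', T t' & t = e1 *+ k + t').

Local Notation U k := ('X_[mon (e0 *+ k)] : {mpoly K[2]}).
Local Notation V k := ('X_[mon (e1 *+ k)] : {mpoly K[2]}).

Lemma mpolyX_monD s t : 'X_[mon (s + t)] = 'X_[mon s] * 'X_[mon t] :> {mpoly K[2]}.
Proof. by rewrite monD mpolyXD. Qed.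

Lemma mdeg_expo m : mdeg m = ((expo m).1 + (expo m).2)%N.
Proof.
rewrite mdegE !big_ord_recl big_ord0 addn0 (_ : lift ord0 ord0 = ord_max :> 'I_2) //.
exact: val_inj.
Qed.

Lemma msuppX_mdeg_ge p k m : p@_0%MM = 0 -> m \in msupp (p ^+ k) -> (k <= mdeg m)%N.
Proof.
move=> p0; elim: k m => // k IHk m.
rewrite exprS => /msupp_mul_split[m1 [m2 [h1 /IHk h2 ->]]].
rewrite mdegD -add1n leq_add // lt0n mdeg_eq0.
by apply: contraTneq h1 => ->; rewrite mcoeff_msupp p0 eqxx.
Qed.

(** A high power of an element of the irrelevant ideal only involves monomials
    of high degree, and these are multiples of [u^(kN)] or of [v^(kN)]. *)
Lemma power_in_UV p k : semigroup_ring p -> p@_0%MM = 0 ->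
  exists L a b, [/\ semigroup_ring a, semigroup_ring b & p ^+ L = a * U k + b * V k].
Proof.
move=> Rp p0; have [D TD_] := Tbig k; exists D.
pose J q := exists a b, [/\ semigroup_ring a, semigroup_ring b & q = a * U k + b * V k].
suff: J (p ^+ D) by [].
rewrite [p ^+ D]mpolyE big_seq; apply: big_ind.
- by exists 0, 0; rewrite !mul0r addr0; split=> //; apply: semigroup_ring0.
- move=> _ _ [a [b [Ra Rb ->]]] [a' [b' [Ra' Rb' ->]]].
  exists (a + a'), (b + b'); split; [exact: semigroup_ringD|exact: semigroup_ringD|].
  by rewrite !mulrDl addrACA.
- move=> m mp; have := TD_ (expo m) (semigroup_ringXn Rp mp).
  rewrite -mdeg_expo => /(_ (msuppX_mdeg_ge p0 mp)) [] [t Tt tE].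
  + exists ((p ^+ D)@_m *: 'X_[mon t]), 0;
    split; [exact/semigroup_ringZ/semigroup_ringX|exact: semigroup_ring0|].
    by rewrite mul0r addr0 -scalerAl -mpolyX_monD addrC -tE expoK.
  + exists 0, ((p ^+ D)@_m *: 'X_[mon t]);
    split; [exact: semigroup_ring0|exact/semigroup_ringZ/semigroup_ringX|].
    by rewrite mul0r add0r -scalerAl -mpolyX_monD addrC -tE expoK.
Qed.

Lemma nonunits_mon t : T t -> t <> 0 -> nonunits local_ring ('X_[mon t])%:F.
Proof.
move=> Tt t0; apply/nonunits_local_ringP; exists 'X_[mon t], 1; rewrite mcoeff0_1_neq0 tofrac1 divr1.
by split=> //; [apply: semigroup_ringX|apply: semigroup_ring1|rewrite mcoeff0_X].
Qed.

Lemma e0k_neq0 k : (0 < k)%N -> e0 *+ k <> 0.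
Proof. by move=> k0; rewrite pair_mulrn => -[]; lia. Qed.

Lemma e1k_neq0 k : (0 < k)%N -> e1 *+ k <> 0.
Proof. by move=> k0; rewrite pair_mulrn => -[]; lia. Qed.

Lemma sop_UV k : (0 < k)%N -> system_of_parameters local_ring [:: (U k)%:F; (V k)%:F].
Proof.
move=> k0; split; first exact: krull_dim_local_ring2.
- move=> x; rewrite !inE => /orP[]/eqP->; apply: nonunits_mon.
  + exact: TMn.
  + exact: e0k_neq0.
  + exact: TMn.
  + exact: e1k_neq0.
- move=> z /nonunits_local_ringP[p [q [Rp Rq q0 p0 ->]]].
  have [L [a [b [Ra Rb E]]]] := power_in_UV k Rp p0.
  exists L; apply/ideal_span2; exists (a%:F / q%:F ^+ L), (b%:F / q%:F ^+ L).
  have BqL : local_ring (q%:F ^+ L)^-1.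
    by rewrite -exprVn; apply: (subringX local_ring_subring); apply: local_ring_inv.
  split.
  + exact: (subringM local_ring_subring (local_ring_tofrac Ra)).
  + exact: (subringM local_ring_subring (local_ring_tofrac Rb)).
  + by rewrite expr_div_n -[p%:F ^+ L]tofracXn E tofracD !tofracM !(mulrAC _ _^-1) -mulrDl.
Qed.

Definition in_hull t : Prop :=
  exists k, T (t + e0 *+ k) /\ T (t + e1 *+ k).

(** Two coprime monomials: comparing the supports of both sides shows that every
    monomial of [p] is divisible by [u^(kN)]. *)
Lemma UV_coprime (p q : {mpoly K[2]}) k : p * V k = q * U k ->
  exists h, p = h * U k /\ q = h * V k.
Proof.
move=> pq; pose w := mon (e0 *+ k).
have wp m : m \in msupp p -> (w <= m)%MM.
  move=> mp; pose v := mon (e1 *+ k); have: (v + m)%MM \in msupp (q * U k).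
    by rewrite -pq mcoeff_msupp mcoeffMX -mcoeff_msupp.
  case/msupp_mul_split => m1 [m2 []] _; rewrite msuppX inE => /eqP-> e.
  have := congr1 expo e; rewrite [in LHS]expoD [in RHS]expoD /v !monK !pair_mulrn => -[h _].
  have := monK (e0 *+ k); rewrite -/w pair_mulrn => -[w0 w1].
  by apply/mnm_lepP => i; case: (I2_cases i) => ->; rewrite ?w0 ?w1; move: h => /=; lia.
exists (\sum_(m <- msupp p) p@_m *: 'X_[m - w]).
set h := \sum_(m <- _) _.
have pE : p = h * U k.
  rewrite [LHS]mpolyE mulr_suml; apply: eq_big_seq => m /wp wm.
  by rewrite -scalerAl -mpolyXD submK.
split=> //; apply: (mulIf (mpolyX_neq0 w)).
by rewrite -pq {1}pE mulrAC.
Qed.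

(** A fraction that multiplies a system of parameters into the local ring
    multiplies high powers of [u^N] and of [v^N] into it as well; up to a unit
    it is then a polynomial whose monomials lie in the hull of [T]. *)
Lemma multiplier_in_hull x0 x1 w :
  system_of_parameters local_ring [:: x0; x1] -> local_ring (w * x0) -> local_ring (w * x1) ->
  exists b h, [/\ semigroup_ring b, b@_0%MM != 0, w * b%:F = h%:F &
    forall m, m \in msupp h -> in_hull (expo m)].
Proof.
move=> [_ _ rad] w0 w1.
have wX t : T t -> t <> 0 -> exists k, local_ring (w * ('X_[mon t])%:F ^+ k).
  move=> Tt t0; have [k /ideal_span2[c [d [Bc Bd XE]]]] := rad _ (nonunits_mon Tt t0).
  exists k; rewrite XE mulrDr ![w * (_ * _)]mulrCA.
  by apply: (subringD local_ring_subring); apply: (subringM local_ring_subring).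
have e00 : e0 <> 0 by case; lia.
have e10 : e1 <> 0 by case; lia.
have [k wk] := wX _ Te0 e00; have [l wl] := wX _ Te1 e10.
pose M := (k + l)%N.
have wU : local_ring (w * (U M)%:F).
  rewrite monMn -mpolyXn tofracXn exprD mulrA; apply: (subringM local_ring_subring) => //.
  by apply: (subringX local_ring_subring); apply/local_ring_tofrac/semigroup_ringX.
have wV : local_ring (w * (V M)%:F).
  rewrite monMn -mpolyXn tofracXn exprD mulrA mulrAC; apply: (subringM local_ring_subring) => //.
  by apply: (subringX local_ring_subring); apply/local_ring_tofrac/semigroup_ringX.
have [p [q [Rp Rq q0 pE]]] := wU; have [p' [q' [Rp' Rq' q'0 pE']]] := wV.
have wUE : w * (q * q')%:F * (U M)%:F = (p * q')%:F.
  rewrite !tofracM (_ : _ * _ = w * (U M)%:F * q%:F * q'%:F); last by ring.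
  by rewrite pE divfK ?tofrac_neq0.
have wVE : w * (q * q')%:F * (V M)%:F = (p' * q)%:F.
  rewrite !tofracM (_ : _ * _ = w * (V M)%:F * q'%:F * q%:F); last by ring.
  by rewrite pE' divfK ?tofrac_neq0.
have [|h [hU hV]] := @UV_coprime (p * q') (p' * q) M.
  apply/eqP; rewrite -tofrac_eq [X in X == _]tofracM [X in _ == X]tofracM -wUE -wVE.
  by rewrite mulrAC.
exists (q * q'), h; split; [exact: semigroup_ringM|exact: mcoeff0M_neq0| |].
  apply: (mulIf (x := (U M)%:F)); first by rewrite tofrac_eq0 mpolyX_neq0.
  by rewrite wUE hU tofracM.
have hT t (x : {mpoly K[2]}) m : semigroup_ring x -> x = h * 'X_[mon t] ->
    m \in msupp h -> T (expo m + t).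
  move=> Rx xE mh; rewrite -[t]monK -expoD; apply: Rx.
  by rewrite xE addmC mcoeff_msupp mcoeffMX -mcoeff_msupp.
move=> m mh; exists M; split.
  exact: hT (semigroup_ringM Rp Rq') hU mh.
exact: hT (semigroup_ringM Rp' Rq) hV mh.
Qed.

(** If the first parameter were zero, the inverse of the second would multiply
    both into the local ring, so it would be a polynomial up to a unit, which the
    inverse of a non-unit cannot be. *)
Lemma sop_head_neq0 x0 x1 : system_of_parameters local_ring [:: x0; x1] -> x0 != 0.
Proof.
move=> sop; apply/eqP => x00.
have [y [nuy y0 wx1]] : exists y, [/\ nonunits local_ring y, y != 0 & local_ring (y^-1 * x1)].
  case: (eqVneq x1 0) => [->|x10].
    exists ('X_[mon e0])%:F; rewrite tofrac_eq0 mpolyX_neq0 mulr0 -tofrac0.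
    split=> //; last exact/local_ring_tofrac/semigroup_ring0.
    by apply: nonunits_mon => // -[]; lia.
  exists x1; split=> //; last by rewrite mulVf // -tofrac1; apply/local_ring_tofrac/semigroup_ring1.
  by case: sop => _ nu _; apply: nu; rewrite !inE eqxx orbT.
have [|b [h [_ b0 wb _]]] := multiplier_in_hull sop _ wx1.
  by rewrite x00 mulr0 -tofrac0; apply/local_ring_tofrac/semigroup_ring0.
have /nonunits_local_ringP[p [q [_ _ q0 p0 yE]]] := nuy.
have pE : p%:F = y * q%:F by rewrite yE divfK ?tofrac_neq0.
have : (b * q)%:F = (h * p)%:F by rewrite !tofracM -wb pE mulrACA mulVf // mul1r.
move/eqP; rewrite tofrac_eq => /eqP/(congr1 (mcoeff 0%MM))/eqP.
by rewrite !mcoeff0M p0 mulr0 (negPf (mulf_neq0 b0 q0)).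
Qed.

(** Both directions read [y x_1 = c x_0] as the fraction [y / x_0 = c / x_1]. The
    fraction [u^t] with [t] in the hull arises from the parameters
    [u^(kN), v^(kN)]; in general [multiplier_in_hull] reduces to such fractions. *)
Theorem local_ring_Buchsbaum :
  Buchsbaum_local local_ring <-> (forall t s : nat * nat, in_hull t -> T s -> s <> 0 -> T (t + s)).
Proof.
have local_ring0 : local_ring 0 by exact: (subring0 local_ring_subring).
split=> [Bu t s [k [Tk0 Tk1]] Ts s0 | hull xs sop].
  case: (posnP k) => [k0|k0]; first by move: Tk0; rewrite k0 addr0 => Tt; apply: TD.
  have := Bu _ (sop_UV k0) 1%N ('X_[mon (t + e0 *+ k)])%:F isT
    (local_ring_tofrac (semigroup_ringX Tk0)).
  have /[swap] /[apply] : ideal_span local_ring [:: (U k)%:F]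
      (('X_[mon (t + e0 *+ k)])%:F * (V k)%:F).
    apply/ideal_span1; exists ('X_[mon (t + e1 *+ k)])%:F.
      exact/local_ring_tofrac/semigroup_ringX.
    by rewrite -!tofracM -!mpolyX_monD addrAC.
  (* The polynomial [q] has a nonzero constant term, hence [u^(t+s)] occurs in [p]. *)
  move/(_ _ (nonunits_mon Ts s0))/ideal_span1 => [c [p [q [Rp Rq q0 ->]]]].
  rewrite mulrAC => e.
  have : ('X_[mon (t + s)] * q)%:F * (U k)%:F = p%:F * (U k)%:F.
    rewrite !tofracM mulrAC -[RHS](divfK (tofrac_neq0 q0)) -e.
    by congr (_ * _); rewrite -!tofracM -!mpolyX_monD addrAC.
  move/(mulIf _); rewrite tofrac_eq0 mpolyX_neq0 => /(_ isT)/eqP.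
  rewrite tofrac_eq => /eqP pE.
  rewrite -[t + s]monK; apply: Rp; rewrite -pE mulrC mcoeff_msupp.
  by rewrite -[X in _@_X]addm0 mcoeffMX.
case: xs sop => [|x0 [|x1 [|x2 xs]]] sop; try by have [/krull_dim_local_ringE] := sop.
have x00 := sop_head_neq0 sop.
case=> [|[|//]] y _ Ly.
  move/(ideal_span0 _ local_ring0)/eqP; rewrite mulf_eq0 (negPf x00) orbF => /eqP-> z _.
  by rewrite mul0r; apply/ideal_span0.
move=> /ideal_span1 /= [c Lc cE] z /nonunits_local_ringP[p [q [Rp Rq q0 p0 ->]]].
apply/ideal_span1.
have [||b [h [Rb b0 wb hT]]] := multiplier_in_hull (w := y / x0) sop.
- by rewrite divfK.
- by rewrite mulrAC cE mulfK.
exists ((h * p)%:F / (b * q)%:F).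
  exists (h * p), (b * q); split=> //; [|exact: semigroup_ringM|exact: mcoeff0M_neq0].
  move=> m /msupp_mul_split[m1 [m2 [/hT hm1 m2p ->]]]; rewrite expoD; apply: hull => //.
    exact: Rp.
  move=> m20; move: m2p; rewrite -[m2]expoK m20 mon0 mcoeff_msupp p0.
  by rewrite eqxx.
rewrite !tofracM -wb -mulf_div -[_ * _ / b%:F]mulrA (mulfV (tofrac_neq0 b0)) mulr1.
by rewrite mulrAC divfK.
Qed.

End SemigroupRing.

(** * The semigroup of a projective monomial curve *)

Section ProjectiveClosure.
Variables (K : fieldType) (r : nat) (n : nat -> nat).
Hypotheses (hn0 : n 0%N = 0%N) (hlt : forall i, (i < r)%N -> (n i < n i.+1)%N).
Hypothesis nr_gt0 : (0 < n r)%N.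
Local Notation N := (n r).
Local Notation T := (T r n).
Local Notation Tstar := (Tstar r n).
Local Notation e0 := ((N, 0%N) : nat * nat).
Local Notation e1 := ((0%N, N) : nat * nat).

Lemma n_le_nr i : (i <= r)%N -> (n i <= N)%N.
Proof.
move: {2}(r - i)%N (erefl (r - i)%N) => d; elim: d i => [|d IHd] i di ir.
  by rewrite (_ : i = r) //; lia.
by apply: leq_trans (IHd i.+1 _ _); [apply/ltnW/hlt|..]; lia.
Qed.

Lemma T_wt t : T t <-> exists c : 'X_{1..r.+1}, t = wt (fun i : 'I_r.+1 => e r n i) c.
Proof.
split=> [[c ->]|[c ->]]; last by exists c.
by exists [multinom c i | i < r.+1]; apply: eq_bigr => i _; rewrite mnmE.
Qed.

Lemma T0 : T 0.
Proof. by exists (fun=> 0%N); rewrite big1. Qed.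

Lemma TD s t : T s -> T t -> T (s + t).
Proof. by move=> /T_wt[c ->] /T_wt[d ->]; apply/T_wt; exists (c + d)%MM; rewrite wtD. Qed.

Lemma Te (i : 'I_r.+1) : T (e r n i).
Proof. by apply/T_wt; exists U_(i)%MM; rewrite wtU. Qed.

Lemma e_ord0 : e r n (ord0 : 'I_r.+1) = e0.
Proof. by rewrite /e /= hn0 subn0. Qed.

Lemma e_ord_max : e r n (ord_max : 'I_r.+1) = e1.
Proof. by rewrite /e /= subnn. Qed.

Lemma Te0 : T e0. Proof. by rewrite -e_ord0; apply: Te. Qed.
Lemma Te1 : T e1. Proof. by rewrite -e_ord_max; apply: Te. Qed.

Lemma e_neq0 i : e r n i <> 0.
Proof. by rewrite /e => -[]; lia. Qed.

Lemma T_split t : T t -> t <> 0 ->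
  exists (i : 'I_r.+1) t', T t' /\ t = e r n i + t'.
Proof.
move=> /T_wt[c ->]; have [-> |c0] := eqVneq c 0%MM.
  by rewrite wt0.
have [i ci] : exists i, (0 < c i)%N.
  apply: NNPP => h; case/eqP: c0; apply/mnmP => i; rewrite mnm0E.
  by apply/eqP; rewrite -leqn0 leqNgt; apply/negP => ci; apply: h; exists i.
move=> _; exists i, (wt (fun i : 'I_r.+1 => e r n i) (c - U_(i))%MM).
split; first by apply/T_wt; exists (c - U_(i))%MM.
rewrite -[X in X + _](wtU (fun i : 'I_r.+1 => e r n i)) -wtD addmC submK //.
by apply/mnm_lepP => j; rewrite mnm1E; case: eqP => [<-|].
Qed.

(** Since [N e_i = n_i e_r + (N - n_i) e_0], a sum of generators in which one
    generator occurs often contains a multiple of [e_0] or of [e_r]. *)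
Lemma T_large k : exists D, forall t, T t -> (D <= t.1 + t.2)%N ->
  (exists2 t', T t' & t = e0 *+ k + t') \/
  (exists2 t', T t' & t = e1 *+ k + t').
Proof.
exists (r.+1 * (N * k * N)).+1 => t /T_wt[c tE] tD.
have [i ci] : exists i, (N * k <= c i)%N.
  apply: NNPP => h; suff : (t.1 + t.2 <= r.+1 * (N * k * N))%N by lia.
  have sD : {morph (fun x : nat * nat => (x.1 + x.2)%N) : x y / x + y >-> (x + y)%N}.
    by move=> x y /=; rewrite addnACA.
  rewrite tE /wt (big_morph _ sD (erefl _)) -[X in (X * _)%N]card_ord -sum_nat_const.
  apply: leq_sum => i _; rewrite /e pair_mulrn /= -mulnDl subnK; last first.
    by apply: n_le_nr; rewrite -ltnS.
  rewrite mulnC leq_mul2r; apply/orP; right; rewrite leqNgt; apply/negP => ci.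
  by apply: h; exists i; apply: ltnW.
have iN : (n i <= N)%N by apply: n_le_nr; rewrite -ltnS.
pose c' := [multinom (c j - (i == j) * (N * k))%N | j < r.+1].
have tE' : t = e r n i *+ (N * k) + wt (fun i : 'I_r.+1 => e r n i) c'.
  rewrite tE (_ : c = (U_(i) *+ (N * k) + c')%MM); last first.
    apply/mnmP => j; rewrite mnmDE mulmnE mnm1E mnmE; case: eqP => [<-|_]; last lia.
    by move: ci; move: (N * k)%N => M; lia.
  by rewrite wtD wtMn wtU.
have Tc' : T (wt (fun i : 'I_r.+1 => e r n i) c') by apply/T_wt; exists c'.
case: (posnP (n i)) => ni.
  left; exists (e0 *+ ((N - 1) * k) + wt (fun i : 'I_r.+1 => e r n i) c').
    by apply: TD => //; apply: TMn T0 TD _ _ Te0.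
  rewrite tE' addrA; congr (_ + _); rewrite /e ni !pair_mulrn.
  by apply: nat_pair_eq => /=; nia.
right; exists (e1 *+ ((n i - 1) * k) + e0 *+ ((N - n i) * k) + wt (fun i : 'I_r.+1 => e r n i) c').
  apply: TD => //; apply: TD; last exact: TMn T0 TD _ _ Te0.
  exact: TMn T0 TD _ _ Te1.
rewrite tE' !addrA; congr (_ + _); rewrite /e !pair_mulrn.
by apply: nat_pair_eq => /=; nia.
Qed.

Lemma proj_closureE (q : {mpoly K[2]}) : proj_closure r n q <-> semigroup_ring T q.
Proof.
split=> [[p ->]|Rq].
  rewrite phiE; apply: (big_ind (semigroup_ring T)).
  - exact: semigroup_ring0.
  - exact: semigroup_ringD.
  - by move=> m _; apply: semigroup_ringZ; apply: semigroup_ringX; apply/T_wt; exists m.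
rewrite [q]mpolyE big_seq; apply: big_ind.
- by exists 0; rewrite /phi comp_mpoly0.
- by move=> _ _ [a ->] [b ->]; exists (a + b); rewrite /phi comp_mpolyD.
- move=> m /Rq/T_wt[c mE]; exists (q@_m *: 'X_[c]).
  by rewrite /phi comp_mpolyZ -/(phi _ _) phiX -mE expoK.
Qed.

Lemma localization_KGammah :
  localization (@KGammah K r n) (@KGammah_irr K r n) = local_ring T.
Proof.
apply: functional_extensionality => x; apply: propositional_extensionality.
split=> [[a [b [[p /proj_closureE Rp ->] [q /proj_closureE Rq ->] nb ->]]]|].
  exists p, q; split=> //; apply/eqP => q0; apply: nb; exists q => //.
  by split=> //; apply/proj_closureE.
move=> [p [q [Rp Rq q0 ->]]]; exists (tofrac p), (tofrac q); split=> //.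
- by exists p => //; apply/proj_closureE.
- by exists q => //; apply/proj_closureE.
- by case=> q' [_ q'0] /eqP; rewrite tofrac_eq => /eqP qq'; move: q0; rewrite qq' q'0 eqxx.
Qed.

Lemma KGammah_BuchsbaumE : KGammah_Buchsbaum K r n <->
  (forall t s : nat * nat, in_hull T N t -> T s -> s <> 0 -> T (t + s)).
Proof.
rewrite /KGammah_Buchsbaum localization_KGammah.
by apply: (local_ring_Buchsbaum K T0 TD nr_gt0 Te0 Te1); apply: T_large.
Qed.

Lemma TstarD z t : Tstar z -> T t -> Tstar (z + toZ2 t).
Proof.
move=> zT Tt i; have [s Ts ->] := zT i; exists (s + t); first exact: TD.
by rewrite toZ2D addrAC.
Qed.

Lemma T_Tstar t : T t -> Tstar (toZ2 t).
Proof.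
by move=> Tt i; exists (t + e r n i); [apply: TD (Te i)|rewrite toZ2D addrK].
Qed.

(** [Tstar] is defined with the generators of [T], but these reach every nonzero
    element of [T]. *)
Lemma TstarP t : Tstar (toZ2 t) <-> forall s, T s -> s <> 0 -> T (t + s).
Proof.
split=> [h s Ts s0|h i]; last first.
  exists (t + e r n i); last by rewrite toZ2D addrK.
  by apply: h; [exact: Te|exact: e_neq0].
have [i [s' [Ts' ->]]] := T_split Ts s0.
have [t' Tt' tE] := h i; rewrite addrA; apply: TD => //.
by rewrite (_ : t + e r n i = t') //; apply: toZ2_inj; rewrite toZ2D tE subrK.
Qed.

(** Saturation is applied one step at a time, first along [e_0] and then along
    [e_r]; adding the other vector does not leave [Tstar]. *)
Lemma Tstar_saturated_multiples :
  saturated e0 e1 Tstar ->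
  forall k l z, Tstar (z + toZ2 e0 *+ k) -> Tstar (z + toZ2 e1 *+ l) -> Tstar z.
Proof.
move=> sat.
have sat1 k z : Tstar (z + toZ2 e0 *+ k) -> Tstar (z + toZ2 e1) -> Tstar z.
  elim: k z => [|k IHk] z; first by rewrite addr0.
  rewrite mulrS addrA => h0 h1; apply: sat => //; apply: IHk => //.
  by rewrite addrAC; apply: TstarD Te0.
move=> k; elim=> [|l IHl] z; first by rewrite addr0.
rewrite mulrS addrA => h0 h1; apply: (sat1 k) => //; apply: IHl => //.
by rewrite addrAC; apply: TstarD Te1.
Qed.

(** Saturation of [Tstar] involves [z + 2 e_0] and [z + 2 e_r] in [T], so [k = 2]
    suffices for one direction; these two elements also force [z] to have
    nonnegative coordinates. *)
Lemma hull_saturated :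
  (forall t s : nat * nat, in_hull T N t -> T s -> s <> 0 -> T (t + s)) <->
  saturated e0 e1 Tstar.
Proof.
split=> [hull z h0 h1|sat t s [k [Tk0 Tk1]]]; last first.
  move: s; apply/TstarP; apply: (Tstar_saturated_multiples sat (k := k) (l := k)).
    by rewrite -toZ2Mn -toZ2D; apply: T_Tstar.
  by rewrite -toZ2Mn -toZ2D; apply: T_Tstar.
have [t0 Tt0 tE0] := h0 ord0; have [t1 Tt1 tE1] := h1 ord_max.
rewrite e_ord0 in tE0; rewrite e_ord_max in tE1.
have zE : z = toZ2 (t1.1, t0.2).
  move: tE0 tE1; case: z {h0 h1} => z1 z2 [_ e2] [e3 _]; congr pair => /=; lia.
rewrite zE in tE0 tE1 *; apply/TstarP => s; apply: hull; exists 2.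
have -> : (t1.1, t0.2) + e0 *+ 2 = t0.
  by apply: toZ2_inj; rewrite toZ2D toZ2Mn mulr2n addrA tE0 subrK.
have -> : (t1.1, t0.2) + e1 *+ 2 = t1.
  by apply: toZ2_inj; rewrite toZ2D toZ2Mn mulr2n addrA tE1 subrK.
by [].
Qed.

End ProjectiveClosure.

Theorem theorem4p1 (K : fieldType) (r : nat) (n : nat -> nat)
    (hn0 : n 0%N = 0%N)
    (hlt : forall i, (i < r)%N -> (n i < n i.+1)%N)
    (hGamma : numerical_semigroup (Gamma r n))
    (hmin : irredundant (fun i : 'I_r => n i.+1))
    (hCM : ~ KGammah_CM K r n)
    (s : nat) (g : 'I_s.+2 -> nat * nat)
    (hg0 : g ord0 = (n r, 0%N))
    (hg1 : g ord_max = (0%N, n r))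
    (hgen : forall z, Tstar r n z <-> generated (fun j => toZ2 (g j)) z)
    (hirr : irredundant (fun j => toZ2 (g j)))
    (G : seq {mpoly K[s.+2]})
    (hG : reduced_groebner_basis (degrevlex g) (toric_ideal (K := K) g) G) :
  KGammah_Buchsbaum K r n <->
  (forall f m, f \in G -> is_lead_mon (degrevlex g) f m ->
     ~~ (U_(ord0) <= m)%MM /\ ~~ (U_(ord_max) <= m)%MM).
Proof.
have g_neq0 j : g j <> 0.
  move=> gj; apply: (hirr j); exists (fun=> 0%N) => //.
  by rewrite gj big1.
have nr_gt0 : (0 < n r)%N.
  by rewrite lt0n; apply/eqP => nr0; apply: (g_neq0 ord0); rewrite hg0 nr0.
rewrite KGammah_BuchsbaumE // hull_saturated //.
rewrite (groebner_saturated g_neq0 hG) hg0 hg1.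
by split=> sat z /hgen h0 /hgen h1; apply/hgen; apply: sat.
Qed.
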